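(* Consider the control-affine discrete-time latent dynamics $$\mathbf{z}_{k+1}=\mathbf{a}_{\varphi_1}(\mathbf{z}_k)+\mathbf{B}_{\varphi_2}(\mathbf{z}_k)\,\mathbf{u}_k,$$ with $\mathbf{a}_{\varphi_1}:\mathbb{R}^r\to\mathbb{R}^r$, $\mathbf{B}_{\varphi_2}:\mathbb{R}^r\to\mathbb{R}^{r\times m}$, $\mathbf{z}_k\in\mathbb{R}^r$, $\mathbf{u}_k\in\mathbb{R}^m$, and let $\mathcal{D}\subset\mathbb{R}^r$ be a domain of interest. Let $\bar{\mathbf{A}}\in\mathbb{R}^{r\times r}$ and $\bar{\mathbf{B}}\in\mathbb{R}^{r\times m}$ be the desired system and input matrices. If $\mathbf{B}_{\varphi_2}(\mathbf{z}_k)$ has full row rank, i.e. $\operatorname{rank}(\mathbf{B}_{\varphi_2}(\mathbf{z}_k))=r$, for all $\mathbf{z}_k\in\mathcal{D}$, then a full-state feedback linearization of these dynamics exists. Under this condition, the linearizing feedback law is given by $$\mathbf{u}_k=\mathbf{B}^{R}_{\varphi_2}(\mathbf{z}_k)\big(\bar{\mathbf{A}}\mathbf{z}_k+\bar{\mathbf{B}}\mathbf{v}_k-\mathbf{a}_{\varphi_1}(\mathbf{z}_k)\big),$$ where $\mathbf{B}^{R}_{\varphi_2}$ denotes the right pseudoinverse of $\mathbf{B}_{\varphi_2}$ and $\mathbf{v}_k\in\mathbb{R}^m$ is the virtual input.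
   Context: Full-state feedback linearization means: there is a feedback law expressing $\mathbf{u}_k$ as a function of $\mathbf{z}_k$ and a new virtual input $\mathbf{v}_k\in\mathbb{R}^m$ such that, for all $\mathbf{z}_k\in\mathcal{D}$ and all $\mathbf{v}_k\in\mathbb{R}^m$, the closed-loop dynamics are the linear dynamics $\mathbf{z}_{k+1}=\bar{\mathbf{A}}\mathbf{z}_k+\bar{\mathbf{B}}\mathbf{v}_k$ with the desired matrices $\bar{\mathbf{A}},\bar{\mathbf{B}}$. The right pseudoinverse of a full-row-rank matrix $\mathbf{B}\in\mathbb{R}^{r\times m}$ is $\mathbf{B}^{R}=\mathbf{B}^T(\mathbf{B}\mathbf{B}^T)^{-1}$, which satisfies $\mathbf{B}\mathbf{B}^{R}=\mathbf{I}_{r\times r}$ and equals $\mathbf{B}^{-1}$ when $r=m$. *)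

(* Defs.v *)
From mathcomp Require Import all_boot all_order all_algebra.
From mathcomp Require Import classical_sets reals.

Set Implicit Arguments.
Unset Strict Implicit.
Unset Printing Implicit Defensive.

Import GRing.Theory.
Local Open Scope ring_scope.

(* [invmx] is total: it returns its argument on singular matrices, so this is
   the right pseudoinverse only when [B *m B^T] is invertible, which over the
   reals means that [B] has full row rank. *)
Definition right_pinv (R : realType) (r m : nat) (B : 'M[R]_(r, m)) :
    'M[R]_(m, r) :=
  B^T *m invmx (B *m B^T).

(* z_(k+1) as a function of z_k and u_k. *)
Definition control_affine_step (R : realType) (r m : nat)
    (a : 'cV[R]_r -> 'cV[R]_r) (B : 'cV[R]_r -> 'M[R]_(r, m))
    (z : 'cV[R]_r) (u : 'cV[R]_m) : 'cV[R]_r :=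
  a z + B z *m u.

(* z_(k+1) as a function of z_k and v_k. *)
Definition linear_step (R : realType) (r m : nat)
    (Abar : 'M[R]_r) (Bbar : 'M[R]_(r, m))
    (z : 'cV[R]_r) (v : 'cV[R]_m) : 'cV[R]_r :=
  Abar *m z + Bbar *m v.

(* A feedback law [K] gives the input as u_k = K z_k v_k; its values at states
   outside the domain [D] are irrelevant. *)
Definition linearizing_feedback (R : realType) (r m : nat)
    (a : 'cV[R]_r -> 'cV[R]_r) (B : 'cV[R]_r -> 'M[R]_(r, m))
    (D : set 'cV[R]_r) (Abar : 'M[R]_r) (Bbar : 'M[R]_(r, m))
    (K : 'cV[R]_r -> 'cV[R]_m -> 'cV[R]_m) : Prop :=
  forall (z : 'cV[R]_r) (v : 'cV[R]_m), D z ->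
    control_affine_step a B z (K z v) = linear_step Abar Bbar z v.

Definition full_state_feedback_linearizable (R : realType) (r m : nat)
    (a : 'cV[R]_r -> 'cV[R]_r) (B : 'cV[R]_r -> 'M[R]_(r, m))
    (D : set 'cV[R]_r) (Abar : 'M[R]_r) (Bbar : 'M[R]_(r, m)) : Prop :=
  exists K : 'cV[R]_r -> 'cV[R]_m -> 'cV[R]_m,
    linearizing_feedback a B D Abar Bbar K.

(* Main.v *)
Require Import Defs.
From mathcomp Require Import all_boot all_order all_algebra.
From mathcomp Require Import classical_sets reals.

(** The desired next state is prescribed by the equation
    [a z + B z *m u = Abar *m z + Bbar *m v] in the unknown [u], which is linear
    in [u]; any right inverse of [B z] produces a solution, and the feedback law
    is the one produced by the pseudoinverse.  The point that needs an argument
    is that the pseudoinverse is a right inverse, that is, that the Gram matrix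
    [B *m B^T] of linearly independent rows is invertible ([gram_unitmx]).  This
    uses the order of the scalars: a row vector [v] in the kernel of the Gram
    matrix satisfies [(v *m B) *m (v *m B)^T = 0], so the sum of the squares of
    the entries of [v *m B] vanishes, and independence of the rows forces
    [v = 0]. *)

Import GRing.Theory Num.Theory.
Local Open Scope ring_scope.

Lemma row_mul_tr_eq0 (R : realDomainType) (n : nat) (w : 'rV[R]_n) :
  w *m w^T = 0 -> w = 0.
Proof.
move=> /matrixP/(_ 0 0); rewrite !mxE => sum_sq0.
have sq_ge0 (j : 'I_n) : true -> 0 <= w 0 j * w^T j 0.
  by move=> _; rewrite mxE -expr2 sqr_ge0.
apply/rowP => j; rewrite mxE; apply/eqP.
have sqj0 : w 0 j * w^T j 0 = 0 by apply: (psumr_eq0P sq_ge0 sum_sq0).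
by move/eqP: sqj0; rewrite mxE mulf_eq0 orbb.
Qed.

(** Over an ordered field the Gram matrix has the same row kernel as [B].  This
    fails over a general field, where a nonzero row can be isotropic. *)
Lemma gram_unitmx (R : realFieldType) (r m : nat) (B : 'M[R]_(r, m)) :
  row_free B -> B *m B^T \in unitmx.
Proof.
move=> freeB; rewrite -row_free_unit; apply: inj_row_free => v vG0.
apply: (row_free_inj freeB); rewrite mul0mx; apply: row_mul_tr_eq0.
by rewrite trmx_mul mulmxA -(mulmxA v) vG0 mul0mx.
Qed.

Lemma mulmx_right_pinv (R : realType) (r m : nat) (B : 'M[R]_(r, m)) :
  row_free B -> B *m right_pinv B = 1%:M.
Proof. by move=> freeB; rewrite /right_pinv mulmxA mulmxV ?gram_unitmx. Qed.

Theorem proposition3 (R : realType) (r m : nat)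
    (a : 'cV[R]_r -> 'cV[R]_r) (B : 'cV[R]_r -> 'M[R]_(r, m))
    (D : set 'cV[R]_r) (Abar : 'M[R]_r) (Bbar : 'M[R]_(r, m))
    (hB : forall z : 'cV[R]_r, D z -> \rank (B z) = r) :
  full_state_feedback_linearizable a B D Abar Bbar /\
  linearizing_feedback a B D Abar Bbar
    (fun (z : 'cV[R]_r) (v : 'cV[R]_m) =>
       right_pinv (B z) *m (Abar *m z + Bbar *m v - a z)).
Proof.
set K := (K in linearizing_feedback _ _ _ _ _ K).
have linK : linearizing_feedback a B D Abar Bbar K.
  move=> z v Dz; rewrite /control_affine_step /linear_step /K mulmxA.
  by rewrite mulmx_right_pinv /row_free ?hB // mul1mx addrC subrK.
by split; first exists K.
Qed.
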